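(* Suppose $(X_t)_{t>0}$ is a quadratic harness with parameters $q,\eta,\theta,\sigma,\tau$ which has finite moments of all orders and martingale polynomials $p_n(x;t)$, $n\ge 0$, $t>0$. Let $C_{k,n}(t)$ be defined by $$x\,p_n(x;t)=\sum_{k=0}^{n+1}C_{k,n}(t)\,p_k(x;t),\qquad n\ge 0,\ t>0,$$ and let $\mathbf C_t=[C_{k,n}(t)]_{k,n\ge 0}$ be the infinite matrix with entry $C_{k,n}(t)$ in row $k$ and column $n$ (so $C_{k,n}(t)=0$ for $k>n+1$). If for each $t>0$ the random variable $X_t$ has infinite support, then there are infinite matrices $\mathsf x,\mathsf y$ (not depending on $t$) such that $$\mathbf C_t=t\,\mathsf x+\mathsf y\quad\text{for all } t>0$$ (so, extending this formula to $t=0$, $\mathsf y=\mathbf C_0$ and $\mathsf x=\mathbf C_1-\mathbf C_0$), and they satisfy the $q$-commutation equation $$\mathsf x\mathsf y-q\,\mathsf y\mathsf x=\mathsf I+\tau\,\mathsf x^2+\sigma\,\mathsf y^2+\theta\,\mathsf x+\eta\,\mathsf y .$$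
   Context: Equalities between conditional expectations hold almost surely. $(X_t)_{t>0}$ is a separable square-integrable real process; $\mathcal F_{s,u}=\sigma\{X_t:t\in(0,s]\cup[u,\infty)\}$, $\mathcal F_{\le s}=\sigma\{X_t:0<t\le s\}$; $\mathrm{Var}[X\mid\mathcal F]=\mathbb{E}[X^2\mid\mathcal F]-(\mathbb{E}[X\mid\mathcal F])^2$; $\Delta_{s,u}=\frac{X_u-X_s}{u-s}$, $\widetilde\Delta_{s,u}=\frac{uX_s-sX_u}{u-s}$. For real $\eta,\theta$, $\sigma,\tau\ge0$ and $q\le 1+2\sqrt{\sigma\tau}$, $(X_t)$ is a quadratic harness with parameters $q,\eta,\theta,\sigma,\tau$ if $\mathbb{E}(X_t)=0$, $\mathbb{E}(X_sX_t)=\min\{s,t\}$ for all $s,t>0$, and for all $0<s<t<u$ $$\mathbb{E}[X_t\mid\mathcal F_{s,u}]=\tfrac{u-t}{u-s}X_s+\tfrac{t-s}{u-s}X_u,$$ $$\mathrm{Var}[X_t\mid\mathcal F_{s,u}]=\tfrac{(u-t)(t-s)}{u(1+\sigma s)+\tau-qs}\Big(1+\eta\widetilde\Delta_{s,u}+\theta\Delta_{s,u}+\sigma\widetilde\Delta_{s,u}^2+\tau\Delta_{s,u}^2-(1-q)\Delta_{s,u}\widetilde\Delta_{s,u}\Big).$$ Martingale polynomials: for each $n\ge0$ and $t>0$, $p_n(x;t)$ is a polynomial in $x$ of degree $n$, and $\mathbb{E}[p_n(X_t;t)\mid\mathcal F_{\le s}]=p_n(X_s;s)$ for $0<s<t$.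 ''$X_t$ has infinite support'' means the support of the law of $X_t$ is an infinite set. $\mathsf I$ is the infinite identity matrix; products of the matrices involved are well defined since each column has finitely many nonzero entries. *)

(* Defs.v *)
From HB Require Import structures.
From mathcomp Require Import all_boot all_order all_algebra.
From mathcomp Require Import all_classical all_reals all_analysis.
Set Implicit Arguments.
Unset Strict Implicit.
Unset Printing Implicit Defensive.
Import Order.TTheory GRing.Theory Num.Theory.
Import numFieldNormedType.Exports.
Local Open Scope classical_set_scope.
Local Open Scope ring_scope.

Section conditional.
Context (d : measure_display) (T : measurableType d) (R : realType).
Variable P : probability T R.
Implicit Types (G : set (set T)) (X Y Z V : T -> R).

(* [Y] is a version of E[X | sigma(G)]; [G] is a system of events generating
   the conditioning sigma-algebra. *)
Definition cond_exp_version G X Y : Prop :=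
  [/\ P.-integrable setT (EFin \o X),
      measurable_fun setT (Y : g_sigma_algebraType G -> R),
      P.-integrable setT (EFin \o Y) &
      forall A, <<s G >> A ->
        (\int[P]_(w in A) (Y w)%:E = \int[P]_(w in A) (X w)%:E)%E].

(* E[X | sigma(G)] = Z almost surely *)
Definition cond_exp_eq G X Z : Prop :=
  exists2 Y, cond_exp_version G X Y & {ae P, forall w, Y w = Z w}.

(* Var[X | sigma(G)] = V almost surely *)
Definition cond_var_eq G X V : Prop :=
  exists Y1 Y2, [/\ cond_exp_version G X Y1,
    cond_exp_version G (fun w => X w ^+ 2) Y2 &
    {ae P, forall w, Y2 w - Y1 w ^+ 2 = V w}].

End conditional.

(* Processes (X_t)_{t > 0} are represented by families indexed by all of R;
   every condition below only involves the variables with positive index. *)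
Section process.
Context (d : measure_display) (T : measurableType d) (R : realType).
Variable P : probability T R.
Implicit Types (X : R -> {RV P >-> R}) (p : nat -> R -> {poly R}).

(* Separability in the sense of Doob. Taking F empty shows that the countable
   set D is automatically dense in ]0, +oo[. *)
Definition separable_process X : Prop :=
  exists D : set R, [/\ countable D, D `<=` `]0, +oo[ &
    {ae P, forall w, forall (a b : R) (F : set R), 0 <= a -> closed F ->
       (forall t, D t -> a < t < b -> F (X t w)) ->
       (forall t, a < t < b -> F (X t w))}].

Definition square_integrable X : Prop :=
  forall t, 0 < t -> (X t : T -> R) \in Lfun P 2%:E.

Definition finite_moments X : Prop :=
  forall n t, 0 < t -> P.-integrable setT (fun w => (X t w ^+ n)%:E).

(* The events (X_t \in B), t \in I, B Borel; they generate sigma(X_t : t in I) *)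
Definition events X (I : set R) : set (set T) :=
  \bigcup_(t in I) preimage_set_system setT (X t) measurable.

Definition past X (s : R) := events X `]0, s].

Definition past_future X (s u : R) := events X (`]0, s] `|` `[u, +oo[).

Definition Delta X (s u : R) (w : T) : R := (X u w - X s w) / (u - s).

Definition Deltat X (s u : R) (w : T) : R := (u * X s w - s * X u w) / (u - s).

Definition quadratic_harness X (q eta theta sigma tau : R) : Prop :=
  [/\ forall t, 0 < t -> ('E_P[X t] = 0)%E,
      forall s t, 0 < s -> 0 < t ->
        ('E_P[(X s \* X t)%R] = (Num.min s t)%:E)%E,
      forall s t u, 0 < s -> s < t -> t < u ->
        cond_exp_eq P (past_future X s u) (X t)
          (fun w => (u - t) / (u - s) * X s w + (t - s) / (u - s) * X u w) &
      forall s t u, 0 < s -> s < t -> t < u ->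
        cond_var_eq P (past_future X s u) (X t)
          (fun w => (u - t) * (t - s) / (u * (1 + sigma * s) + tau - q * s) *
             (1 + eta * Deltat X s u w + theta * Delta X s u w
              + sigma * Deltat X s u w ^+ 2 + tau * Delta X s u w ^+ 2
              - (1 - q) * Delta X s u w * Deltat X s u w))].

Definition martingale_polynomials X p : Prop :=
  (forall n t, 0 < t -> size (p n t) = n.+1) /\
  (forall n s t, 0 < s -> s < t ->
     cond_exp_eq P (past X s)
       (fun w => (p n t).[X t w]) (fun w => (p n s).[X s w])).

(* Support of the law of a random variable *)
Definition law_support (Y : {RV P >-> R}) : set R :=
  [set x | forall U : set R, open U -> U x -> (0 < distribution P Y U)%E].

End process.

(* Entry (k, n) of the product of two infinite matrices: the sum runs over the
   finite support of its summand, which is finite as soon as the n-th column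
   of [b] is. *)
Definition infmx_mul (R : realType) (a b : nat -> nat -> R) (k n : nat) : R :=
  \sum_(j \in [set: nat]) a k j * b j n.

(* Main.v *)
Require Import Defs.
From HB Require Import structures.
From mathcomp Require Import all_boot all_order all_algebra.
From mathcomp Require Import all_classical all_reals all_analysis.
From mathcomp Require Import measurable_realfun ring lra.
Set Implicit Arguments.
Unset Strict Implicit.
Unset Printing Implicit Defensive.
Import Order.TTheory GRing.Theory Num.Theory.
Import numFieldNormedType.Exports.
Import HBNNSimple.
Local Open Scope classical_set_scope.
Local Open Scope ring_scope.

(* For a polynomial D, test everything against D(X_s). With s < t < u, the
   martingale property moves p_n(X_u; u) down to earlier times and the
   three-term expansion of x p_n turns multiplication by X_r into the matrix
   C_r, so E[X_r X_r' p_n(X_u; u) D(X_s)] is governed by C_r C_r' (r <= r').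
   Infinite support makes the functionals D |-> E[p_k(X_s; s) D(X_s)] linearly
   independent, so identities between moments become identities between
   matrices. The conditional mean of X_t then says that t |-> C_t is affine on
   ]0, +oo[, and the conditional variance gives an equation between C_t^2,
   C_s^2, C_s C_u and C_u^2; after substituting C_t = t x + y it reduces to the
   q-commutation equation, for any single choice of s < t < u. *)

(** * Integrals against functions measurable for a sub-sigma-algebra *)

Section sub_sigma_algebra.
Context (d : measure_display) (T : measurableType d) (R : realType).
Variables (P : probability T R) (G : set (set T)).
Hypothesis GT : G `<=` measurable.

Lemma generated_measurable (A : set T) : <<s G >> A -> measurable A.
Proof. by apply: smallest_sub => //; exact: sigma_algebra_measurable. Qed.

Lemma measurable_fun_generated (f : T -> R) :
  measurable_fun setT (f : g_sigma_algebraType G -> R) -> measurable_fun setT f.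
Proof. by move=> mf m B mB; apply: generated_measurable; exact: mf. Qed.

(** A simple function is a finite combination of indicators of its level sets; these lie in
    sigma(G), where [D] integrates to zero. *)
Lemma integral_mul_nnsfun_eq0 (D : T -> R) (g : {nnsfun g_sigma_algebraType G >-> R}) :
  P.-integrable setT (EFin \o D) ->
  (forall A, <<s G >> A -> \int[P]_(w in A) (D w)%:E = 0)%E ->
  (\int[P]_w (D w * (g : _ -> _) w)%:E = 0)%E.
Proof.
move=> iD D0.
pose s : seq R := finmap.enum_fset (fset_set (range g)).
have sA i : <<s G >> (g @^-1` [set s`_i]) by exact: (measurable_sfunP g).
have mA i : measurable (g @^-1` [set s`_i] : set T).
  exact: generated_measurable.
transitivity (\int[P]_w (\sum_(i < size s) (s`_i)%:E *
    ((D w)%:E * (\1_(g @^-1` [set s`_i] : set T) w)%:E)))%E.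
  apply: eq_integral => w _; rewrite (fimfunEord g) -/s mulr_sumr -sumEFin.
  by apply: eq_bigr => i _; rewrite mulrCA.
have iDi i : P.-integrable setT (fun w => (D w)%:E * (\1_(g @^-1` [set s`_i] : set T) w)%:E)%E.
  apply: (le_integrable _ _ _ iD) => //.
    apply: emeasurable_funM; first exact: (measurable_int P).
    by apply/measurable_EFinP; apply: measurable_indic.
  move=> w _; rewrite lee_fin normrM ler_piMr// indicE ger0_norm//.
  by rewrite lern1 leq_b1.
rewrite integral_sum//; last by move=> i; exact: integrableZl.
apply: big1 => i _.
rewrite integralZl//.
rewrite [X in (_ * X)%E](_ : _ = 0%E) ?mule0//.
rewrite -[RHS](D0 _ (sA i)) [RHS]integral_mkcond; apply: eq_integral => w _.
by rewrite patchE indicE; case: ifP => _; rewrite ?mule1 ?mule0.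
Qed.

(** Simple sigma(G)-measurable functions increase to [h]; dominated convergence with bound |D h|
    passes the simple case to the limit. *)
Lemma integral_mul_ge0_eq0 (D h : T -> R) :
  P.-integrable setT (EFin \o D) ->
  measurable_fun setT (h : g_sigma_algebraType G -> R) ->
  (forall w, 0 <= h w) ->
  P.-integrable setT (EFin \o (D \* h)) ->
  (forall A, <<s G >> A -> \int[P]_(w in A) (D w)%:E = 0)%E ->
  (\int[P]_w (D w * h w)%:E = 0)%E.
Proof.
move=> iD mh h0 iDh D0.
have [g [gnd gh]] := @approximation _ (g_sigma_algebraType G) R setT
  (@measurableT _ (g_sigma_algebraType G)) (EFin \o h)
  (proj2 (measurable_EFinP _ _) mh) (fun w _ => h0 w).
have mT : measurable (setT : set T) by exact: measurableT.
have mg n : measurable_fun setT (g n : T -> R).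
  apply: measurable_fun_generated; exact: measurable_funPT.
have gle n w : (g n : T -> R) w <= h w.
  have gcv : (g^~ w : nat -> R) @ \oo --> h w.
    by have /fine_cvgP[_] := gh w I.
  rewrite -(cvg_lim _ gcv)//; apply: nondecreasing_cvgn_le.
    by move=> m k mk; have /lefP := gnd _ _ mk; apply.
  by apply/cvg_ex; exists (h w).
have mD : measurable_fun setT D by apply/measurable_EFinP/(measurable_int P).
have [|||||_ _] := @dominated_convergence _ T R P setT mT
  (fun n w => (D w * (g n : T -> R) w)%:E) (fun w => (D w * h w)%:E)
  (fun w => `|(D w * h w)%:E|%E).
- by move=> n; apply/measurable_EFinP; exact: measurable_funM.
- exact: (measurable_int P).
- apply: aeW => w _.
  have := @cvgeZl _ _ _ _ _ (D w)%:E isT (gh w I).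
  by rewrite /= -EFinM.
- exact: integrable_abse.
- apply: aeW => w n _; rewrite lee_fin !normrM ler_wpM2l//.
  by rewrite ger0_norm// (le_trans (gle n w))// ler_norm.
rewrite (_ : (fun n => _) = cst 0%E); last first.
  by apply/funext => n /=; rewrite integral_mul_nnsfun_eq0.
by move/cvg_lim => <-//; rewrite lim_cst.
Qed.

(** Split [h] into positive and negative parts; |D h| dominates both products with [D]. *)
Lemma integral_mul_eq0 (D h : T -> R) :
  P.-integrable setT (EFin \o D) ->
  measurable_fun setT (h : g_sigma_algebraType G -> R) ->
  P.-integrable setT (EFin \o (D \* h)) ->
  (forall A, <<s G >> A -> \int[P]_(w in A) (D w)%:E = 0)%E ->
  (\int[P]_w (D w * h w)%:E = 0)%E.
Proof.
move=> iD mh iDh D0.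
have mT : measurable (setT : set T) by exact: measurableT.
have mD : measurable_fun setT D by apply/measurable_EFinP/(measurable_int P).
have mh' := measurable_fun_generated mh.
have ip : P.-integrable setT (EFin \o (D \* h^\+)).
  apply: (le_integrable _ _ _ iDh) => //.
    by apply/measurable_EFinP; apply: measurable_funM => //; exact: measurable_funrpos.
  move=> w _; rewrite lee_fin !normrM ler_wpM2l// ger0_norm ?funrpos_ge0//.
  by rewrite /funrpos ge_max ler_norm normr_ge0.
have im : P.-integrable setT (EFin \o (D \* h^\-)).
  apply: (le_integrable _ _ _ iDh) => //.
    by apply/measurable_EFinP; apply: measurable_funM => //; exact: measurable_funrneg.
  move=> w _; rewrite lee_fin !normrM ler_wpM2l// ger0_norm ?funrneg_ge0//.
  by rewrite /funrneg ge_max ler_normlW ?normrN// normr_ge0.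
transitivity (\int[P]_w ((D w * h^\+ w)%:E - (D w * h^\- w)%:E))%E.
  by apply: eq_integral => w _; rewrite -[in LHS](funrposBneg h)/= mulrBr EFinB.
rewrite integralB_EFin// !integral_mul_ge0_eq0 ?sube0//.
- exact: measurable_funrneg.
- exact: measurable_funrpos.
Qed.
End sub_sigma_algebra.

(** * Conditional expectations: uniqueness, conditional squares and test functions *)

Section conditional_expectation.
Context (d : measure_display) (T : measurableType d) (R : realType).
Variables (P : probability T R) (G : set (set T)).
Hypothesis GT : G `<=` measurable.

(** The difference [D] of two versions integrates to zero over every event of sigma(G), in
    particular over its own sign sets. *)
Lemma cond_exp_version_unique (X Y Y' : T -> R) :
  cond_exp_version P G X Y -> cond_exp_version P G X Y' ->
  {ae P, forall w, Y w = Y' w}.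
Proof.
move=> [_ mY iY YX] [_ mY' iY' Y'X].
pose D : T -> R := Y \- Y'.
have iD : P.-integrable setT (EFin \o D).
  by apply: (integrableB (mu := P) measurableT iY iY').
have mD : measurable_fun setT (D : g_sigma_algebraType G -> R).
  exact: measurable_funB.
have D0 A : <<s G >> A -> (\int[P]_(w in A) (D w)%:E = 0)%E.
  move=> sA; have mA := generated_measurable GT sA.
  under eq_integral do rewrite EFinB.
  have iYA : P.-integrable A (EFin \o Y) by apply: integrableS iY.
  have iYA' : P.-integrable A (EFin \o Y') by apply: integrableS iY'.
  rewrite integralB_EFin// YX// Y'X// -Y'X// subee//.
  exact: integrable_fin_num.
(* Where [D] keeps one sign, the integral of |D| is plus or minus that of [D], hence zero. *)
have DA0 A : <<s G >> A -> (forall w, A w -> 0 <= D w) \/ (forall w, A w -> D w <= 0) ->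
    {ae P, forall w, A w -> D w = 0}.
  move=> sA sgnD; have mA := generated_measurable GT sA.
  have : ae_eq P A (EFin \o D) (cst 0%E).
    have mDA : measurable_fun A (EFin \o D).
      by apply/measurable_EFinP/measurable_funTS/(measurable_fun_generated GT).
    apply/ae_eq_integral_abs => //.
    case: sgnD => sgnD.
      rewrite -[RHS](D0 _ sA); apply: eq_integral => w /set_mem Aw.
      by rewrite /= ger0_norm ?sgnD.
    transitivity (\int[P]_(w in A) (- (D w)%:E))%E.
      by apply: eq_integral => w /set_mem Aw; rewrite /= ler0_norm ?sgnD.
    have iDA : P.-integrable A (EFin \o D) by apply: integrableS iD.
    rewrite integralN.
      by rewrite D0 ?oppe0.
    by have := integrable_add_def mA iDA.
  by apply: filterS => w /= Dw Aw; case: (Dw Aw).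
have s1 : <<s G >> [set w | 0 <= D w].
  have := mD measurableT `[0, +oo[%classic (measurable_itv _).
  rewrite setTI; suff -> : [set w | 0 <= D w] = D @^-1` `[0, +oo[%classic by [].
  by apply/seteqP; split => w /=; rewrite in_itv/= andbT.
have s2 : <<s G >> [set w | D w <= 0].
  have := mD measurableT `]-oo, 0]%classic (measurable_itv _).
  rewrite setTI; suff -> : [set w | D w <= 0] = D @^-1` `]-oo, 0]%classic by [].
  by apply/seteqP; split => w /=; rewrite in_itv.
have := DA0 _ s2 (or_intror (fun _ => id)).
apply: filterS2 (DA0 _ s1 (or_introl (fun _ => id))) => w /= D1 D2.
have [/D1|/ltW/D2] := leP 0 (D w); rewrite /D /= => /eqP; by rewrite subr_eq0 => /eqP.
Qed.

(* [cond_var_eq] comes with its own version of E[X | G], hence the appeal to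
   uniqueness. *)
Lemma cond_exp_eq_sqr (X Y V : T -> R) :
  cond_exp_eq P G X Y -> cond_var_eq P G X V ->
  cond_exp_eq P G (fun w => X w ^+ 2) (fun w => V w + Y w ^+ 2).
Proof.
move=> [Y0 Y0v Y0Y] [Y1 [Y2 [Y1v Y2v Y12V]]]; exists Y2 => //.
have Y01 := cond_exp_version_unique Y0v Y1v.
apply: filterS3 Y0Y Y01 Y12V => w <- -> <-.
by rewrite subrK.
Qed.

(** The bridge from conditional statements to moment identities: [X - Z] integrates to zero over
    sigma(G), hence is orthogonal to [h]. *)
Lemma cond_exp_eq_mul (X Z h : T -> R) :
  cond_exp_eq P G X Z -> P.-integrable setT (EFin \o Z) ->
  measurable_fun setT (h : g_sigma_algebraType G -> R) ->
  P.-integrable setT (EFin \o (X \* h)) ->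
  P.-integrable setT (EFin \o (Z \* h)) ->
  \int[P]_w (X w * h w) = \int[P]_w (Z w * h w).
Proof.
move=> [Y [iX mY iY YX] YZ] iZ mh iXh iZh.
have mT : measurable (setT : set T) by exact: measurableT.
apply/eqP; rewrite -subr_eq0 -RintegralB//; apply/eqP.
rewrite /Rintegral; under eq_integral do rewrite -mulrBl.
rewrite (@integral_mul_eq0 _ _ _ P G GT (X \- Z) h)//.
- by apply: (integrableB (mu := P) mT iX iZ).
- rewrite (_ : _ \o _ = ((EFin \o (X \* h)%R) \- (EFin \o (Z \* h)%R))%E); last first.
    by apply/funext => w /=; rewrite mulrBl EFinB.
  exact: integrableB.
move=> A sA; have mA := generated_measurable GT sA.
under eq_integral do rewrite EFinB.
have iXA : P.-integrable A (EFin \o X) by apply: integrableS iX.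
have iZA : P.-integrable A (EFin \o Z) by apply: integrableS iZ.
rewrite integralB_EFin// -YX//.
(* The defining property concerns the version [Y]; it carries over to [Z] by almost sure
   equality. *)
rewrite (_ : (\int[P]_(w in A) (Y w)%:E = \int[P]_(w in A) (Z w)%:E)%E).
  by rewrite subee//; exact: integrable_fin_num.
have iYA : P.-integrable A (EFin \o Y) by apply: integrableS iY.
apply: ae_eq_integral => //.
- exact: (measurable_int P).
- exact: (measurable_int P).
- by apply: filterS YZ => w /= ->.
Qed.

End conditional_expectation.

(** * Polynomials in random variables and moments of all orders *)

Lemma measurable_fun_horner d (T : measurableType d) (R : realType)
    (D : {poly R}) (f : T -> R) :
  measurable_fun setT f -> measurable_fun setT (fun w => D.[f w]).
Proof.
move=> mf; apply: (measurableT_comp (f := horner D)) mf.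
by apply: continuous_measurable_fun; exact: continuous_horner.
Qed.

Section all_moments.
Context (d : measure_display) (T : measurableType d) (R : realType).
Variable P : probability T R.
Implicit Types (f g : T -> R).

(** This class is closed under sums, products and polynomials, so it settles every integrability
    condition met below. *)
Definition all_moments f := measurable_fun setT f /\
  forall n, P.-integrable setT (fun w => (f w ^+ n)%:E).

Let mT : measurable (setT : set T). Proof. exact: measurableT. Qed.

Lemma all_moments_integrable f :
  all_moments f -> P.-integrable setT (EFin \o f).
Proof.
by move=> [_ /(_ 1)]; congr (_.-integrable _ _); apply/funext => w; rewrite /= expr1.
Qed.

(** Follows from |xy| <= x^2 + y^2 with x = f^a and y = g^b, a consequence of (|x| - |y|)^2 >= 0. *)
Let integrable_mulX f g a b : all_moments f -> all_moments g ->
  P.-integrable setT (fun w => (f w ^+ a * g w ^+ b)%:E).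
Proof.
move=> [mf fi] [mg gi].
have i2 : P.-integrable setT
    ((fun w => (f w ^+ (a * 2))%:E) \+ (fun w => (g w ^+ (b * 2))%:E))%E.
  exact: integrableD.
apply: (le_integrable _ _ _ i2) => //.
  by apply/measurable_EFinP; apply: measurable_funM; exact: measurable_funX.
move=> w _; rewrite -EFinD !exprM lee_fin [leRHS]ger0_norm ?addr_ge0 ?sqr_ge0//.
set x := f w ^+ a; set y := g w ^+ b.
have : 0 <= (`|x| - `|y|) ^+ 2 by exact: sqr_ge0.
rewrite sqrrB !real_normK ?num_real// normrM => xy.
have := sqr_ge0 x; have := sqr_ge0 y; lra.
Qed.

Lemma all_momentsM f g : all_moments f -> all_moments g ->
  all_moments (fun w => f w * g w).
Proof.
move=> fM gM; split=> [|n]; first by apply: measurable_funM; [case: fM|case: gM].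
under eq_fun do rewrite exprMn; exact: integrable_mulX.
Qed.

Lemma all_momentsD f g : all_moments f -> all_moments g ->
  all_moments (fun w => f w + g w).
Proof.
move=> fM gM; split=> [|n]; first by apply: measurable_funD; [case: fM|case: gM].
under eq_fun do rewrite exprDn -sumEFin.
apply: integrable_sum => // i _.
under eq_fun do rewrite -mulr_natl EFinM.
by apply: integrableZl => //; exact: integrable_mulX.
Qed.

Lemma all_moments_cst c : all_moments (fun=> c).
Proof.
split=> [|n]; first exact: measurable_cst.
exact: finite_measure_integrable_cst.
Qed.

Lemma all_moments_horner (D : {poly R}) f :
  all_moments f -> all_moments (fun w => D.[f w]).
Proof.
move=> fM; elim/poly_ind: D => [|D c DM].
  by under eq_fun do rewrite horner0; exact: all_moments_cst.
under eq_fun do rewrite hornerMXaddC.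
by apply: all_momentsD (all_moments_cst c); exact: all_momentsM.
Qed.

Lemma all_moments_expectationD f g : all_moments f -> all_moments g ->
  \int[P]_w (f w + g w) = \int[P]_w f w + \int[P]_w g w.
Proof.
by move=> /all_moments_integrable fi /all_moments_integrable gi; exact: RintegralD.
Qed.

Lemma all_moments_expectationZ c f : all_moments f ->
  \int[P]_w (c * f w) = c * \int[P]_w f w.
Proof. by move=> /all_moments_integrable fi; exact: RintegralZl. Qed.

Lemma all_moments_expectation_sum n (c : 'I_n -> R) (F : 'I_n -> T -> R) :
  (forall i, all_moments (F i)) ->
  \int[P]_w (\sum_(i < n) c i * F i w) = \sum_(i < n) c i * \int[P]_w F i w.
Proof.
move=> FM; have FI i := all_moments_integrable (FM i).
rewrite /Rintegral; under eq_integral do rewrite -sumEFin.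
rewrite integral_sum//; last first.
  by move=> i; under eq_fun do rewrite EFinM; exact: (integrableZl mT (c i) (FI i)).
rewrite -sum_fine => [|i _].
  by apply: eq_bigr => i _; exact: (all_moments_expectationZ (c i) (FM i)).
apply: integrable_fin_num => //; under eq_fun do rewrite EFinM.
exact: (integrableZl mT (c i) (FI i)).
Qed.

End all_moments.

(** * Infinite support, freeness of graded polynomials, and an algebraic expansion *)

(** Every support point is a root: otherwise the open set where [D] is nonzero would have positive
    probability. A nonzero polynomial has too few roots for that. *)
Lemma poly_infinite_support_eq0 (d : measure_display) (T : measurableType d)
    (R : realType) (P : probability T R) (Y : {RV P >-> R}) (D : {poly R}) :
  infinite_set (law_support Y) -> {ae P, forall w, D.[Y w] = 0} -> D = 0.
Proof.
move=> supp D0; apply/eqP/negPn/negP => Dn0.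
(* [size D] points suffice, since a nonzero [D] has strictly fewer distinct roots than its size. *)
have [B Bs Bn] := infinite_set_fset (size D) supp.
have rB : all (root D) (finmap.enum_fset B).
  apply/allP => x xB; apply/negPn/negP => rx.
  have : law_support Y x by exact: Bs.
  move=> /(_ (horner D @^-1` [set~ 0])).
  have oU : open (horner D @^-1` [set~ 0]).
    apply: open_comp; first by move=> ? _; apply: continuous_horner.
    by apply: closed_openC; exact: (@closed_eq R 0).
  move=> /(_ oU); rewrite /distribution /pushforward /=.
  move=> /(_ (fun E => negP rx (introT rootP E))).
  have [N [mN PN sN]] := D0.
  suff -> : P (Y @^-1` (horner D @^-1` [set~ 0])) = 0 by rewrite ltxx.
  apply: (subset_measure0 _ mN _ PN) => //.
  rewrite -[X in measurable X]setTI; apply: (measurable_funPT Y) => //.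
  exact: open_measurable.
have := max_poly_roots Dn0 rB (finmap.fset_uniq B).
by rewrite ltnNge Bn.
Qed.

(** Only the last polynomial reaches the top degree, so its coefficient vanishes; then induct. *)
Lemma graded_poly_free (R : idomainType) (p : nat -> {poly R}) (c : nat -> R) N :
  (forall k, size (p k) = k.+1) -> \sum_(k < N) c k *: p k = 0 ->
  forall k, (k < N)%N -> c k = 0.
Proof.
move=> szp; elim: N => [//|N IH]; rewrite big_ord_recr/= => pc0.
have cN0 : c N = 0.
  have := congr1 (fun u : {poly R} => u`_N) pc0.
  rewrite coefD coef_sum big1 => [|i _]; last first.
    by rewrite coefZ (@nth_default _ _ (p i)) ?mulr0// szp.
  rewrite add0r coefZ coef0 => /eqP; rewrite mulf_eq0 => /orP[/eqP//|].
  have -> : (p N)`_N = lead_coef (p N) by rewrite lead_coefE szp.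
  by rewrite lead_coef_eq0 -size_poly_eq0 szp.
move: pc0; rewrite cN0 scale0r addr0 => /IH cI k.
by rewrite ltnS leq_eqVlt => /orP[/eqP->//|]; exact: cI.
Qed.

(** Conditional variance plus squared conditional mean, sorted by monomials in x = X_s and y = X_u.
    Keeping [v] abstract in place of 1/(u - s) makes this a pure ring identity. *)
Lemma conditional_square_expand (R : comNzRingType)
    (q eta theta sigma tau s u K v a b x y : R) :
  K * (1 + eta * ((u * x - s * y) * v) + theta * ((y - x) * v)
       + sigma * ((u * x - s * y) * v) ^+ 2 + tau * ((y - x) * v) ^+ 2
       - (1 - q) * ((y - x) * v) * ((u * x - s * y) * v)) + (a * x + b * y) ^+ 2 =
  K + (K * (eta * u - theta) * v * x + (K * (theta - eta * s) * v * y
    + ((a ^+ 2 + K * (sigma * u ^+ 2 + tau + (1 - q) * u) * v ^+ 2) * (x * x)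
    + ((2 * a * b - K * (2 * sigma * u * s + 2 * tau + (1 - q) * (u + s)) * v ^+ 2)
       * (y * x)
    + (b ^+ 2 + K * (sigma * s ^+ 2 + tau + (1 - q) * s) * v ^+ 2) * (y * y))))).
Proof. ring. Qed.

(** * Moments of the process and the matrix identities they imply *)

Section harness.
Context (d : measure_display) (T : measurableType d) (R : realType).
Variables (P : probability T R) (X : R -> {RV P >-> R}).

Lemma events_measurable (I : set R) : events X I `<=` measurable.
Proof.
move=> A [t It [B mB <-]]; apply: (measurable_funPT (X t)) => //.
Qed.

Lemma measurable_fun_events (I : set R) t : I t ->
  measurable_fun setT (X t : g_sigma_algebraType (events X I) -> R).
Proof.
move=> It _ B mB; apply: sub_sigma_algebra; exists t => //; exists B => //.
Qed.

Hypothesis X_moments : finite_moments X.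

Lemma all_moments_process t : 0 < t -> all_moments P (X t).
Proof. by move=> t0; split=> [|n]; [exact: measurable_funPT|exact: X_moments]. Qed.

Variables (p : nat -> R -> {poly R}) (C : R -> nat -> nat -> R).
Hypotheses (p_mart : martingale_polynomials X p)
  (C_def : forall n (t : R), 0 < t ->
     'X * p n t = \sum_(k < n.+2) C t k n *: p k t)
  (C_band : forall n k (t : R), 0 < t -> (n.+1 < k)%N -> C t k n = 0).

Lemma martingale_poly_test n r u h : 0 < r -> r <= u -> all_moments P h ->
  measurable_fun setT (h : g_sigma_algebraType (past X r) -> R) ->
  \int[P]_w ((p n u).[X u w] * h w) = \int[P]_w ((p n r).[X r w] * h w).
Proof.
move=> r0; rewrite le_eqVlt => /orP[/eqP->//|ru] hM mh.
have u0 := lt_trans r0 ru.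
have puM := all_moments_horner (p n u) (all_moments_process u0).
have prM := all_moments_horner (p n r) (all_moments_process r0).
apply: (cond_exp_eq_mul (@events_measurable `]0, r]%classic) (p_mart.2 n r u r0 ru)) => //.
- exact: all_moments_integrable.
- by apply: all_moments_integrable; exact: all_momentsM.
- by apply: all_moments_integrable; exact: all_momentsM.
Qed.

Definition poly_moment s (D : {poly R}) k :=
  \int[P]_w ((p k s).[X s w] * D.[X s w]).

(** The cutoff [N] is free so that expansions of different lengths share one index range; the band
    condition pads with zeros. *)
Lemma recurrence_moment n t h N : 0 < t -> (n.+2 <= N)%N -> all_moments P h ->
  \int[P]_w ((p n t).[X t w] * (X t w * h w)) =
  \sum_(k < N) C t k n * \int[P]_w ((p k t).[X t w] * h w).
Proof.
move=> t0 nN hM; have tM := all_moments_process t0.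
rewrite -all_moments_expectation_sum => [|k]; last first.
  by apply: all_momentsM => //; exact: all_moments_horner.
apply: eq_Rintegral => w _; rewrite mulrA [_ * X t w]mulrC.
have -> : X t w * (p n t).[X t w] = ('X * p n t).[X t w] by rewrite hornerM hornerX.
rewrite C_def// horner_sum mulr_suml.
rewrite (big_ord_widen _ (fun k => (C t k n *: p k t).[X t w] * h w) nN).
rewrite big_mkcond/=; apply: eq_bigr => k _.
by case: ltnP => [_|nk]; rewrite ?hornerZ ?mulrA// C_band ?mul0r.
Qed.

(** Descend from time [u] to [r], absorb X_r by the recurrence, then descend from [r] to [s]. *)
Lemma first_moment_expansion n s r u D N : 0 < s -> s <= r -> r <= u -> (n.+2 <= N)%N ->
  \int[P]_w ((p n u).[X u w] * (X r w * D.[X s w])) =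
  \sum_(k < N) C r k n * poly_moment s D k.
Proof.
move=> s0 sr ru nN; have r0 := lt_le_trans s0 sr.
have sM := all_moments_process s0; have rM := all_moments_process r0.
have DM := all_moments_horner D sM.
have past_s t : s <= t ->
    measurable_fun setT (X s : g_sigma_algebraType (past X t) -> R).
  by move=> st; apply: measurable_fun_events; rewrite /= in_itv/= s0.
rewrite (martingale_poly_test _ r0 ru); first last.
- apply: measurable_funM; last exact: measurable_fun_horner (past_s _ sr).
  by apply: measurable_fun_events; rewrite /= in_itv/= r0 lexx.
- exact: all_momentsM.
rewrite (recurrence_moment r0 nN DM); apply: eq_bigr => k _; congr (_ * _).
by apply: martingale_poly_test => //; exact: measurable_fun_horner (past_s _ (lexx s)).
Qed.

(** The later factor X_r' is absorbed first, while X_r still belongs to the past of [r']; this fixes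
    the order of the matrix product. *)
Lemma second_moment_expansion n s r r' u D N :
  0 < s -> s <= r -> r <= r' -> r' <= u -> (n.+3 <= N)%N ->
  \int[P]_w ((p n u).[X u w] * (X r' w * (X r w * D.[X s w]))) =
  \sum_(k < N) (\sum_(j < n.+2) C r k j * C r' j n) * poly_moment s D k.
Proof.
move=> s0 sr rr' r'u nN; have r0 := lt_le_trans s0 sr.
have r'0 := lt_le_trans r0 rr'.
have sM := all_moments_process s0; have rM := all_moments_process r0.
have r'M := all_moments_process r'0.
have DM := all_moments_horner D sM.
rewrite (martingale_poly_test _ r'0 r'u); first last.
- apply: measurable_funM; last apply: measurable_funM.
  + by apply: measurable_fun_events; rewrite /= in_itv/= r'0 lexx.
  + by apply: measurable_fun_events; rewrite /= in_itv/= r0 rr'.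
  + apply: measurable_fun_horner.
    by apply: measurable_fun_events; rewrite /= in_itv/= s0 (le_trans sr).
- by apply: all_momentsM => //; exact: all_momentsM.
rewrite (recurrence_moment r'0 (leqnn _)); last exact: all_momentsM.
(* Here j is at most n + 1 and X_r raises the degree once more, which is why [N] must be at least n
   + 3. *)
under eq_bigr => j _.
  rewrite (@first_moment_expansion _ _ _ _ _ N)//; last by rewrite (leq_trans _ nN)// ltnS ltn_ord.
  rewrite mulr_sumr.
  over.
rewrite exchange_big/=; apply: eq_bigr => k _; rewrite mulr_suml.
by apply: eq_bigr => j _; rewrite mulrCA mulrA.
Qed.

(** Testing against the combination of the p_k with coefficients [c] itself gives E[D(X_s)^2] = 0,
    so [D] vanishes almost surely at X_s and is the zero polynomial. *)
Lemma poly_moment_free (s : R) (c : nat -> R) N : 0 < s -> infinite_set (law_support (X s)) ->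
  (forall D, \sum_(k < N) c k * poly_moment s D k = 0) ->
  forall k, (k < N)%N -> c k = 0.
Proof.
move=> s0 supp c0; apply: (@graded_poly_free _ (p ^~ s)).
  by move=> k; exact: p_mart.1.
set D := \sum_(k < N) _.
have sM := all_moments_process s0; have DM := all_moments_horner D sM.
apply: (poly_infinite_support_eq0 supp).
have D2 : \int[P]_w (D.[X s w] * D.[X s w]) = 0.
  rewrite -[RHS](c0 D) -all_moments_expectation_sum => [|k]; last first.
    by apply: all_momentsM => //; exact: all_moments_horner.
  apply: eq_Rintegral => w _; rewrite {1}/D horner_sum mulr_suml.
  by apply: eq_bigr => k _; rewrite hornerZ mulrA.
have iD2 := all_moments_integrable (all_momentsM DM DM).
have mD2 := measurable_int P iD2.
have : (\int[P]_w `|(EFin \o (fun w => D.[X s w] * D.[X s w])%R) w| = 0)%E.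
  rewrite -[RHS]/(0%R)%:E -D2 fineK; last exact: integrable_fin_num.
  by apply: eq_integral => w _ /=; rewrite -expr2 ger0_norm ?sqr_ge0.
move/(ae_eq_integral_abs _ measurableT mD2).
apply: filterS => w /= /(_ I) [] /eqP.
by rewrite mulf_eq0 orbb => /eqP.
Qed.


(** The conditional mean is tested against p_n(X_u; u) D(X_s), which is measurable for the past of
    [s] and the future of [u]; freeness then compares coefficients. *)
Lemma harness_affine q eta theta sigma tau s t u n k :
  quadratic_harness X q eta theta sigma tau ->
  (forall r, 0 < r -> infinite_set (law_support (X r))) ->
  0 < s -> s < t -> t < u ->
  C t k n = (u - t) / (u - s) * C s k n + (t - s) / (u - s) * C u k n.
Proof.
move=> [_ _ X_lin _] supp s0 st tu.
have t0 := lt_trans s0 st; have u0 := lt_trans t0 tu.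
have sM := all_moments_process s0; have tM := all_moments_process t0.
have uM := all_moments_process u0.
have puM := all_moments_horner (p n u) uM.
set a := (u - t) / (u - s); set b := (t - s) / (u - s).
pose c k := C t k n - a * C s k n - b * C u k n.
suff : c k = 0 by rewrite /c => /eqP; rewrite -addrA -opprD subr_eq0 => /eqP.
(* n + 2 terms hold the whole expansion; k + 1 keeps the index [k] in range even outside the
   band. *)
apply: (@poly_moment_free s c (maxn n.+2 k.+1) s0 (supp s s0)); last first.
  by rewrite leq_max ltnSn orbT.
move=> D; have DM := all_moments_horner D sM.
have hM : all_moments P (fun w => (p n u).[X u w] * D.[X s w]) by exact: all_momentsM.
have aM := all_momentsM (all_moments_cst P a) sM.
have bM := all_momentsM (all_moments_cst P b) uM.
have abM := all_momentsD aM bM.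
have := cond_exp_eq_mul (@events_measurable (`]0, s] `|` `[u, +oo[)%classic)
  (X_lin s t u s0 st tu) (all_moments_integrable abM) _
  (all_moments_integrable (all_momentsM tM hM))
  (all_moments_integrable (all_momentsM abM hM)).
have mh : measurable_fun setT
   ((fun w => (p n u).[X u w] * D.[X s w]) : g_sigma_algebraType (past_future X s u) -> R).
  apply: measurable_funM; apply: measurable_fun_horner; apply: measurable_fun_events.
    by right; rewrite /= in_itv/= lexx.
  by left; rewrite /= in_itv/= s0 lexx.
move=> /(_ mh).
have nN : (n.+2 <= maxn n.+2 k.+1)%N by rewrite leq_max leqnn.
have M1 r : s <= r -> r <= u -> 0 < r ->
  \int[P]_w (X r w * ((p n u).[X u w] * D.[X s w])) =
  \sum_(k0 < maxn n.+2 k.+1) C r k0 n * poly_moment s D k0.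
  move=> sr ru r0; rewrite -(first_moment_expansion _ s0 sr ru nN).
  by apply: eq_Rintegral => w _; rewrite mulrCA.
rewrite (M1 t)// ?ltW//.
have hsM := all_momentsM sM hM; have huM := all_momentsM uM hM.
pose h w := (p n u).[X u w] * D.[X s w].
have -> : \int[P]_w ((a * X s w + b * X u w) * h w) =
    a * \int[P]_w (X s w * h w) + b * \int[P]_w (X u w * h w).
  rewrite -!all_moments_expectationZ// -all_moments_expectationD.
  - by apply: eq_Rintegral => w _; rewrite /h /= !mulrDl -!mulrA.
  - exact: (all_momentsM (all_moments_cst P a) hsM).
  - exact: (all_momentsM (all_moments_cst P b) huM).
rewrite !M1// ?(ltW (lt_trans st tu))// => E.
under eq_bigr => j _.
  rewrite (_ : c j * _ = C t j n * poly_moment s D j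
    - (a * (C s j n * poly_moment s D j) + b * (C u j n * poly_moment s D j)));
    last by rewrite /c; ring.
  over.
by rewrite sumrB big_split/= -!mulr_sumr E subrr.
Qed.

(* Entry (k, n) of the product C_r C_r': the entries of column n of C_r' vanish
   below row n + 1. *)
Definition second_moment_mx r r' k n := \sum_(j < n.+2) C r k j * C r' j n.
Local Notation MM := second_moment_mx.

(** The conditional second moment is tested against the same functions. The mixed term is [MM s u]
    because the later time [u] is absorbed first. *)
Lemma harness_quadratic q eta theta sigma tau s t u n k :
  quadratic_harness X q eta theta sigma tau ->
  (forall r, 0 < r -> infinite_set (law_support (X r))) ->
  0 < s -> s < t -> t < u ->
  let K := (u - t) * (t - s) / (u * (1 + sigma * s) + tau - q * s) in
  let v := (u - s)^-1 in let a := (u - t) * v in let b := (t - s) * v in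
  MM t t k n =
    K * (n == k)%:R + K * (eta * u - theta) * v * C s k n
    + K * (theta - eta * s) * v * C u k n
    + (a ^+ 2 + K * (sigma * u ^+ 2 + tau + (1 - q) * u) * v ^+ 2) * MM s s k n
    + (2 * a * b - K * (2 * sigma * u * s + 2 * tau + (1 - q) * (u + s)) * v ^+ 2)
       * MM s u k n
    + (b ^+ 2 + K * (sigma * s ^+ 2 + tau + (1 - q) * s) * v ^+ 2) * MM u u k n.
Proof.
move=> [_ _ X_lin X_var] supp s0 st tu K v a b.
have t0 := lt_trans s0 st; have u0 := lt_trans t0 tu.
have sM := all_moments_process s0; have tM := all_moments_process t0.
have uM := all_moments_process u0.
have puM := all_moments_horner (p n u) uM.
set c0 := K; set c1 := K * (eta * u - theta) * v.
set c2 := K * (theta - eta * s) * v.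
set c11 := a ^+ 2 + _; set c12 := 2 * a * b - _; set c22 := b ^+ 2 + _.
pose c k := MM t t k n - (c0 * (n == k)%:R + c1 * C s k n + c2 * C u k n
  + c11 * MM s s k n + c12 * MM s u k n + c22 * MM u u k n).
suff : c k = 0 by rewrite /c => /eqP; rewrite subr_eq0 => /eqP.
pose N := maxn n.+3 k.+1.
have nN : (n.+3 <= N)%N by rewrite leq_max leqnn.
apply: (@poly_moment_free s c N s0 (supp s s0)); last first.
  by rewrite leq_max ltnSn orbT.
move=> D; have DM := all_moments_horner D sM.
pose h w := (p n u).[X u w] * D.[X s w].
have hM : all_moments P h by exact: all_momentsM.
have hsM := all_momentsM sM hM; have huM := all_momentsM uM hM.
have hssM := all_momentsM sM hsM; have husM := all_momentsM uM hsM.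
have huuM := all_momentsM uM huM.
have zM e f (fM : all_moments P f) := all_momentsM (all_moments_cst P e) fM.
(* The nesting of sums follows the right-hand side of [conditional_square_expand], so that the two
   match syntactically. *)
have Q1M := all_momentsD (zM c1 _ sM) (all_momentsD (zM c2 _ uM)
  (all_momentsD (zM c11 _ (all_momentsM sM sM)) (all_momentsD
  (zM c12 _ (all_momentsM uM sM)) (zM c22 _ (all_momentsM uM uM))))).
have QM := all_momentsD (all_moments_cst P c0) Q1M.
have X2M : all_moments P (fun w => X t w ^+ 2) by exact: all_momentsM.
have mh : measurable_fun setT (h : g_sigma_algebraType (past_future X s u) -> R).
  apply: measurable_funM; apply: measurable_fun_horner; apply: measurable_fun_events.
    by right; rewrite /= in_itv/= lexx.
  by left; rewrite /= in_itv/= s0 lexx.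
have := cond_exp_eq_sqr (@events_measurable (`]0, s] `|` `[u, +oo[)%classic)
  (X_lin s t u s0 st tu) (X_var s t u s0 st tu).
set Q := (X in cond_exp_eq _ _ _ X).
have -> : Q = (fun w => c0 + (c1 * X s w + (c2 * X u w + (c11 * (X s w * X s w) +
    (c12 * (X u w * X s w) + c22 * (X u w * X u w)))))).
  by apply/funext => w; exact: conditional_square_expand.
move=> X2Q.
have := cond_exp_eq_mul (@events_measurable (`]0, s] `|` `[u, +oo[)%classic)
  X2Q (all_moments_integrable QM) mh
  (all_moments_integrable (all_momentsM X2M hM))
  (all_moments_integrable (all_momentsM QM hM)).
have su := lt_trans st tu.
(* With no factor X_r, the martingale property alone leads down to time [s]; this is the source of
   the identity matrix. *)
have M0 : \int[P]_w h w = \sum_(k0 < N) (n == k0)%:R * poly_moment s D k0.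
  rewrite /h (martingale_poly_test _ s0 (ltW su))//; last first.
    apply: measurable_fun_horner; apply: measurable_fun_events.
    by rewrite /= in_itv/= s0 lexx.
  have nN' : (n < N)%N by rewrite (leq_trans _ nN)// !ltnS leqW// leqW.
  rewrite (bigD1 (Ordinal nN'))//= eqxx mul1r big1 ?addr0// => j jn.
  by rewrite (_ : (n == j) = false) ?mul0r//; apply/negbTE; rewrite eq_sym.
have M1 r : s <= r -> r <= u -> 0 < r ->
  \int[P]_w (X r w * h w) = \sum_(k0 < N) C r k0 n * poly_moment s D k0.
  move=> sr ru r0; rewrite -(first_moment_expansion _ s0 sr ru (ltnW nN)).
  by apply: eq_Rintegral => w _; rewrite mulrCA.
have M2 r r' : s <= r -> r <= r' -> r' <= u -> 0 < r ->
  \int[P]_w (X r' w * (X r w * h w)) = \sum_(k0 < N) MM r r' k0 n * poly_moment s D k0.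
  move=> sr rr' ru r0; rewrite -(second_moment_expansion _ s0 sr rr' ru nN).
  by apply: eq_Rintegral => w _; rewrite /h; ring.
under eq_Rintegral do rewrite expr2 -mulrA.
rewrite M2// ?ltW//.
have -> : \int[P]_w ((c0 + (c1 * X s w + (c2 * X u w + (c11 * (X s w * X s w) +
      (c12 * (X u w * X s w) + c22 * (X u w * X u w)))))) * h w) =
    c0 * \int[P]_w h w + (c1 * \int[P]_w (X s w * h w)
    + (c2 * \int[P]_w (X u w * h w) + (c11 * \int[P]_w (X s w * (X s w * h w))
    + (c12 * \int[P]_w (X u w * (X s w * h w))
    + c22 * \int[P]_w (X u w * (X u w * h w)))))).
  have D5 := zM c22 _ huuM.
  have D4 := all_momentsD (zM c12 _ husM) D5.
  have D3 := all_momentsD (zM c11 _ hssM) D4.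
  have D2 := all_momentsD (zM c2 _ huM) D3.
  have D1 := all_momentsD (zM c1 _ hsM) D2.
  rewrite -!all_moments_expectationZ//.
  rewrite -(all_moments_expectationD (zM c12 _ husM) D5).
  rewrite -(all_moments_expectationD (zM c11 _ hssM) D4).
  rewrite -(all_moments_expectationD (zM c2 _ huM) D3).
  rewrite -(all_moments_expectationD (zM c1 _ hsM) D2).
  rewrite -(all_moments_expectationD (zM c0 _ hM) D1).
  by apply: eq_Rintegral => w _; rewrite /h /= !mulrDl -!mulrA.
rewrite M0 !M1 ?M2 ?(ltW su)// => E.
under eq_bigr => j _.
  rewrite (_ : c j * _ = MM t t j n * poly_moment s D j
    - (c0 * ((n == j)%:R * poly_moment s D j)
    + (c1 * (C s j n * poly_moment s D j)
    + (c2 * (C u j n * poly_moment s D j)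
    + (c11 * (MM s s j n * poly_moment s D j)
    + (c12 * (MM s u j n * poly_moment s D j)
    + c22 * (MM u u j n * poly_moment s D j))))))); last by rewrite /c; ring.
  over.
by rewrite sumrB !big_split/= -!mulr_sumr E subrr.
Qed.

End harness.

(** * Products of banded matrices and the commutation equation *)

Lemma infmx_mul_band (R : realType) (a b : nat -> nat -> R) k n :
  (forall j, (n.+1 < j)%N -> b j n = 0) ->
  infmx_mul a b k n = \sum_(j < n.+2) a k j * b j n.
Proof.
move=> b0; rewrite /infmx_mul -(fsbig_widen (`I_n.+2) setT)//.
  exact/esym/(fsbig_ord _ n.+2 (fun j => a k j * b j n)).
by move=> j [_ /= /negP]; rewrite -leqNgt => nj; rewrite b0 ?mulr0.
Qed.

(** By the bound on [q] and s < u, the denominator is at least (u - s) + (s sqrt(sigma) -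
    sqrt(tau))^2. *)
Lemma variance_denominator_gt0 (R : realType) (q sigma tau s u : R) :
  0 <= sigma -> 0 <= tau -> q <= 1 + 2 * Num.sqrt (sigma * tau) ->
  0 < s -> s < u -> 0 < u * (1 + sigma * s) + tau - q * s.
Proof.
move=> sigma0 tau0 q_le s0 su; have u0 := lt_trans s0 su.
rewrite sqrtrM// in q_le.
set x := Num.sqrt sigma in q_le; set y := Num.sqrt tau in q_le.
have x2 : x ^+ 2 = sigma by rewrite sqr_sqrtr.
have y2 : y ^+ 2 = tau by rewrite sqr_sqrtr.
have qs : q * s <= (1 + 2 * (x * y)) * s by rewrite ler_wpM2r// ltW.
have xy : 0 <= sigma * s * s - 2 * (x * y) * s + tau.
  by rewrite -x2 -y2 [leRHS](_ : _ = (x * s - y) ^+ 2) ?sqr_ge0//; ring.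
have ss : sigma * s * s <= sigma * s * u.
  by apply: ler_wpM2l (ltW su); rewrite mulr_ge0// ltW.
lra.
Qed.

Theorem theorem2p3 (d : measure_display) (T : measurableType d) (R : realType)
    (P : probability T R) (X : R -> {RV P >-> R})
    (q eta theta sigma tau : R)
    (p : nat -> R -> {poly R}) (C : R -> nat -> nat -> R)
    (sigma_ge0 : 0 <= sigma) (tau_ge0 : 0 <= tau)
    (q_le : q <= 1 + 2 * Num.sqrt (sigma * tau))
    (X_sep : separable_process X) (X_L2 : square_integrable X)
    (X_qh : quadratic_harness X q eta theta sigma tau)
    (X_moments : finite_moments X)
    (p_mart : martingale_polynomials X p)
    (C_def : forall n t, 0 < t ->
       'X * p n t = \sum_(k < n.+2) C t k n *: p k t)
    (C_band : forall n k t, 0 < t -> (n.+1 < k)%N -> C t k n = 0)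
    (X_supp : forall t, 0 < t -> infinite_set (law_support (X t))) :
  exists x y : nat -> nat -> R,
    (forall t, 0 < t -> forall k n, C t k n = t * x k n + y k n) /\
    (forall k n,
       infmx_mul x y k n - q * infmx_mul y x k n =
       (k == n)%:R + tau * infmx_mul x x k n + sigma * infmx_mul y y k n
       + theta * x k n + eta * y k n).
Proof.
(* Slope and intercept of the line through times 1 and 2, because the hypotheses say nothing about
   [C] at time 0. *)
pose x k n := C 2 k n - C 1 k n; pose y k n := 2 * C 1 k n - C 2 k n.
have Caff s t u n k : 0 < s -> s < t -> t < u ->
    (u - s) * C t k n = (u - t) * C s k n + (t - s) * C u k n.
  move=> s0 st tu; have us : u - s != 0 by rewrite subr_eq0 gt_eqF// (lt_trans st).
  rewrite (harness_affine X_moments p_mart C_def C_band n k X_qh X_supp s0 st tu).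
  by field.
have Cxy t : 0 < t -> forall k n, C t k n = t * x k n + y k n.
  move=> t0 k n; rewrite /x /y.
  (* Affinity is known only for a time between two others, so the position of [t] relative to 1 and
     2 decides which of the three is in the middle. *)
  have [t1|t1|->] := ltgtP t 1; last by ring.
    by have := Caff t 1 2 n k t0 t1 ltac:(lra); lra.
  have [t2|t2|->] := ltgtP t 2; last by ring.
    by have := Caff 1 t 2 n k ltr01 t1 t2; lra.
  by have := Caff 1 2 t n k ltr01 ltac:(lra) t2; lra.
exists x, y; split=> // k n.
have xn j : (n.+1 < j)%N -> x j n = 0 by move=> nj; rewrite /x !C_band ?subrr.
have yn j : (n.+1 < j)%N -> y j n = 0.
  by move=> nj; rewrite /y !C_band// mulr0 subrr.
rewrite !infmx_mul_band//.
set xy := \sum_(j < _) _ * y j n; set yx := \sum_(j < _) y k j * _.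
set xx := \sum_(j < _) _; set yy := \sum_(j < _) _.
(* Bilinear expansion of (r x + y)(r' x + y), with x on the left carrying r. *)
have MM r r' : 0 < r -> 0 < r' -> second_moment_mx C r r' k n =
    r * r' * xx + r * xy + r' * yx + yy.
  move=> r0 r'0; rewrite /second_moment_mx /xx /xy /yx /yy !mulr_sumr -!big_split/=.
  by apply: eq_bigr => j _; rewrite !Cxy//; ring.
have lt12 : 1 < 2 :> R by lra.
have lt23 : 2 < 3 :> R by lra.
(* At times 1, 2, 3 one has (u - t)(t - s) = 1, so multiplying by the denominator [D] yields the
   commutation equation with no further scaling. *)
have := harness_quadratic X_moments p_mart C_def C_band n k X_qh X_supp ltr01 lt12 lt23.
have den := variance_denominator_gt0 sigma_ge0 tau_ge0 q_le ltr01 (lt_trans lt12 lt23).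
rewrite /= !MM// !Cxy// eq_sym.
set D := 3 * _ + _ - _ in den *; move/gt_eqF/negbT in den.
move=> /(congr1 ( *%R D))/eqP; rewrite -subr_eq0 => /eqP E.
by apply/eqP; rewrite -subr_eq0 -E /D; apply/eqP; field; rewrite /D !mulr1 in den.
Qed.
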